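(* Let $\lambda\in\mathbb{R}$ and let $r\ge 0$ be an integer. For all integers $m,k$ with $k\ge m\ge 0$, $${k+1+r \brace m+r}_{r,\lambda}=\sum_{l=m-1}^{k}\binom{k}{l}(1-\lambda)_{k-l,\lambda}{l+r \brace m+r-1}_{r,\lambda}+r\sum_{l=m}^{k}\binom{k}{l}(-\lambda)_{k-l,\lambda}{l+r \brace m+r}_{r,\lambda}.$$
   Context: For $\lambda\in\mathbb{R}$ and $y$ a number or indeterminate, $(y)_{0,\lambda}=1$ and $(y)_{n,\lambda}=y(y-\lambda)(y-2\lambda)\cdots(y-(n-1)\lambda)$ for $n\ge 1$. Also $(y)_{0}=1$ and $(y)_{n}=y(y-1)\cdots(y-n+1)$ for $n\ge1$. For an integer $r\ge 0$, the degenerate $r$-Stirling numbers of the second kind ${n+r \brace k+r}_{r,\lambda}$ ($0\le k\le n$) are defined by the polynomial identity $$(y+r)_{n,\lambda}=\sum_{k=0}^{n}{n+r \brace k+r}_{r,\lambda}(y)_{k}\quad (n\ge 0).$$ Conventions: ${n+r\brace k+r}_{r,\lambda}=0$ if $k<0$ or $k>n$ or $n<0$, and $\binom{k}{l}=0$ if $l<0$; here ${l+r\brace m+r-1}_{r,\lambda}$ means ${l+r\brace (m-1)+r}_{r,\lambda}$. In particular the first sum is $0$ when $m=0$. *)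

(* Defs.v *)
From HB Require Import structures.
From mathcomp Require Import all_boot all_order all_algebra.
Set Implicit Arguments.
Unset Strict Implicit.
Unset Printing Implicit Defensive.
Import Order.TTheory GRing.Theory Num.Theory.
Local Open Scope ring_scope.

(* (y)_{n,lam}.  The ordinary falling factorial (y)_n is the case lam = 1.
   The indeterminate y is 'X : {poly R}, with lam embedded as lam%:P. *)
Definition dfall (A : comNzRingType) (lam y : A) (n : nat) : A :=
  \prod_(i < n) (y - lam *+ i).

Section FallingBasis.
Variable R : comNzRingType.
Implicit Types (p : {poly R}) (c : nat -> R).

Lemma dfallX_monic_size (mu b : R) n :
  dfall mu%:P ('X + b%:P) n \is monic /\
  size (dfall mu%:P ('X + b%:P) n) = n.+1.
Proof.
have -> : dfall mu%:P ('X + b%:P) n = \prod_(i < n) ('X - (mu *+ i - b)%:P).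
  by apply: eq_bigr => i _; rewrite polyCB polyCMn opprB addrA.
split; first by apply: monic_prod => i _; apply: monicXsubC.
by rewrite size_prod_XsubC /index_enum unlock -enumT size_enum_ord.
Qed.

Lemma fallX_monic_size n :
  dfall 1 ('X : {poly R}) n \is monic /\ size (dfall 1 ('X : {poly R}) n) = n.+1.
Proof. by have := dfallX_monic_size 1 0 n; rewrite polyC0 addr0 polyC1. Qed.

Lemma coef_fall_top c n :
  (\sum_(k < n.+1) c k *: dfall 1 ('X : {poly R}) k)`_n = c n.
Proof.
have [mon sz] := fallX_monic_size n.
rewrite big_ord_recr coefD coefZ coef_sum big1 => [|i _].
  by move/monicP: mon; rewrite lead_coefE sz add0r /= => ->; rewrite mulr1.
by rewrite coefZ nth_default ?mulr0 // (fallX_monic_size i).2.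
Qed.

Lemma fall_basis_exists n p : (size p <= n)%N ->
  exists c, p = \sum_(k < n) c k *: dfall 1 'X k.
Proof.
elim: n p => [|n IHn] p sz_p.
  by exists (fun=> 0); rewrite big_ord0; apply/eqP; rewrite -size_poly_leq0.
have [mon sz] := fallX_monic_size n.
have [|c Ec] := IHn (p - p`_n *: dfall 1 'X n).
  apply/leq_sizeP => j; rewrite leq_eqVlt => /predU1P[<-|lt_nj].
    move/monicP: mon; rewrite lead_coefE sz /= => En.
    by rewrite coefB coefZ En mulr1 subrr.
  rewrite coefB coefZ (nth_default _ (leq_trans sz_p lt_nj)).
  by rewrite [X in _ * X]nth_default ?sz // mulr0 subr0.
exists (fun k => if (k < n)%N then c k else p`_n).
rewrite big_ord_recr /= ltnn -[LHS](subrK (p`_n *: dfall 1 'X n)) Ec.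
by congr (_ + _); apply: eq_bigr => i _; rewrite ltn_ord.
Qed.

Lemma fall_basis_inj n c c' :
  \sum_(k < n) c k *: dfall 1 ('X : {poly R}) k
    = \sum_(k < n) c' k *: dfall 1 'X k ->
  forall k, (k < n)%N -> c k = c' k.
Proof.
elim: n => // n IHn eq_cc'.
have Ec : c n = c' n by rewrite -(coef_fall_top c) eq_cc' coef_fall_top.
move: eq_cc'; rewrite !big_ord_recr /= Ec => /addIr/IHn eq_lt k.
by rewrite ltnS leq_eqVlt => /predU1P[->|/eq_lt].
Qed.

Lemma dstirling2_exists (lam : R) (r n : nat) :
  exists s : {ffun 'I_n.+1 -> R},
    dfall lam%:P ('X + r%:R) n == \sum_(k < n.+1) s k *: dfall 1 'X k.
Proof.
have [_ sz] := dfallX_monic_size lam r%:R n; rewrite polyC_natr in sz.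
have [|c Ec] := @fall_basis_exists n.+1 (dfall lam%:P ('X + r%:R) n).
  by rewrite sz.
by exists [ffun k => c (val k)]; apply/eqP; rewrite {1}Ec; apply: eq_bigr => k _;
   rewrite ffunE.
Qed.

End FallingBasis.

(* dstirling2 lam r n k is {n+r brace k+r}_{r,lam}: both indices are unshifted.
   It is the coefficient of (y)_k in (y+r)_{n,lam}, and 0 outside 0 <= k <= n. *)
Definition dstirling2 (R : comNzRingType) (lam : R) (r n : nat) (k : int) : R :=
  if k is Posz j then
    if insub j is Some i then xchoose (dstirling2_exists lam r n) i else 0
  else 0.

Lemma dstirling2_def (R : comNzRingType) (lam : R) (r n : nat) :
  dfall lam%:P ('X + r%:R) n
    = \sum_(k < n.+1) dstirling2 lam r n k%:Z *: dfall 1 'X k.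
Proof.
rewrite {1}(eqP (xchooseP (dstirling2_exists lam r n))).
by apply: eq_bigr => k _; rewrite /dstirling2 valK.
Qed.

Lemma dstirling2_out (R : comNzRingType) (lam : R) (r n : nat) (k : int) :
  (k < 0) || (n%:Z < k) -> dstirling2 lam r n k = 0.
Proof.
by case: k => // j /=; rewrite ltz_nat => lt_nj; rewrite insubN // -leqNgt.
Qed.

Lemma dstirling2_unique (R : comNzRingType) (lam : R) (r n : nat) (c : nat -> R) :
  dfall lam%:P ('X + r%:R) n = \sum_(k < n.+1) c k *: dfall 1 'X k ->
  forall k, (k <= n)%N -> dstirling2 lam r n k%:Z = c k.
Proof.
rewrite dstirling2_def => eq_c k le_kn.
exact: (fall_basis_inj (c := fun k : nat => dstirling2 lam r n k%:Z) eq_c).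
Qed.

(* Main.v *)
Require Import Defs.
From mathcomp Require Import all_boot all_order all_algebra.
From mathcomp Require Import reals.
From mathcomp Require Import ring.
Import Order.TTheory GRing.Theory Num.Theory.
Local Open Scope ring_scope.

(* With y the indeterminate, split
     (y+r)_{k+1,lam} = y (y+r-lam)_{k,lam} + r (y+r-lam)_{k,lam}.
   Write y+r-lam as (1-lam) + (y-1+r) in the first term and as (-lam) + (y+r)
   in the second, expand both by the degenerate Vandermonde convolution, use
   y (y-1)_j = (y)_{j+1}, and compare the coefficients of (y)_m. *)

Local Arguments dstirling2 : simpl never.

Section DegenerateFalling.
Variable A : comNzRingType.
Implicit Types lam x y : A.

Lemma dfallS lam y n : dfall lam y n.+1 = dfall lam y n * (y - lam *+ n).
Proof. by rewrite /dfall big_ord_recr. Qed.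

Lemma dfallSl lam y n : dfall lam y n.+1 = y * dfall lam (y - lam) n.
Proof.
rewrite /dfall big_ord_recl mulr0n subr0; congr (_ * _).
by apply: eq_bigr => i _; rewrite /bump /= mulrS opprD addrA.
Qed.

(** Induction on [n]: in the [l]-th term the new factor [x + y - lam *+ n] splits as
    [(x - lam *+ (n - l)) + (y - lam *+ l)], which raises the order of one of the two factorials;
    Pascal's rule merges the two resulting sums. *)
Lemma dfallD lam x y n :
  dfall lam (x + y) n =
    \sum_(l < n.+1) 'C(n, l)%:R * dfall lam x (n - l) * dfall lam y l.
Proof.
elim: n => [|n IHn]; first by rewrite big_ord1 /dfall !big_ord0 !mulr1.
rewrite dfallS IHn mulr_suml.
transitivity
  (\sum_(l < n.+1) 'C(n, l)%:R * dfall lam x (n.+1 - l) * dfall lam y l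
   + \sum_(l < n.+1) 'C(n, l)%:R * dfall lam x (n - l) * dfall lam y l.+1).
  rewrite -big_split; apply: eq_bigr => -[l /= lt_ln] _.
  rewrite subSn // !dfallS.
  have -> : lam *+ n = lam *+ (n - l) + lam *+ l by rewrite -mulrnDr subnK.
  by ring.
rewrite [RHS]big_ord_recl /= bin0.
under [in RHS]eq_bigr => i _.
  rewrite /bump /= add1n binS natrD subSS !mulrDl; over.
rewrite big_split /= addrA; congr (_ + _).
rewrite [LHS]big_ord_recl /= bin0; congr (_ + _).
(* The extra top term carries ['C(n, n.+1)], which is 0. *)
by rewrite [RHS]big_ord_recr /= bin_small // !mul0r addr0.
Qed.

End DegenerateFalling.

Lemma rmorph_dfall (A B : comNzRingType) (f : {rmorphism A -> B}) (lam y : A) n :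
  f (dfall lam y n) = dfall (f lam) (f y) n.
Proof.
by rewrite /dfall rmorph_prod; apply: eq_bigr => i _; rewrite rmorphB rmorphMn.
Qed.

Section DegenerateStirling.
Variable R : comNzRingType.
Variables (lam : R) (r : nat).

(** A bound [N] independent of [n] allows expansions for different [n] to be summed and their sums
    exchanged. *)
Lemma dstirling2_sum_widen n N : (n < N)%N ->
  dfall lam%:P ('X + r%:R) n
    = \sum_(j < N) dstirling2 lam r n j%:Z *: dfall 1 'X j.
Proof.
move=> lt_nN; rewrite dstirling2_def.
rewrite (big_ord_widen N (fun j => dstirling2 lam r n j%:Z *: dfall 1 'X j)) //.
rewrite big_mkcond; apply: eq_bigr => j _; case: ltnP => // lt_nj.
by rewrite dstirling2_out ?scale0r // ltz_nat lt_nj orbT.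
Qed.

(** Composing the defining expansion with ['X - 1] and multiplying by ['X] turns each basis element
    of order [j] into the one of order [j.+1]. *)
Lemma mulX_dfall_shift n N : (n < N)%N ->
  'X * dfall lam%:P ('X - 1 + r%:R) n
    = \sum_(j < N.+1) dstirling2 lam r n (j%:Z - 1) *: dfall 1 'X j.
Proof.
move=> lt_nN.
have -> : dfall lam%:P ('X - 1 + r%:R) n
          = dfall lam%:P ('X + r%:R) n \Po ('X - 1).
  by rewrite rmorph_dfall /= comp_polyC comp_polyD comp_polyX rmorph_nat.
rewrite (dstirling2_sum_widen _ _ lt_nN) rmorph_sum mulr_sumr big_ord_recl.
(* The term [j = 0] on the right has lower index -1, so it vanishes by convention. *)
rewrite dstirling2_out ?scale0r ?add0r //; apply: eq_bigr => j _.
by rewrite /= comp_polyZ rmorph_dfall rmorph1 /= comp_polyX -scalerAr -dfallSl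
  /bump add1n -predn_int.
Qed.

Lemma dfallD_polyC (a : R) (p : {poly R}) n :
  dfall lam%:P (a%:P + p) n
    = \sum_(l < n.+1) ('C(n, l)%:R * dfall lam a (n - l)) *: dfall lam%:P p l.
Proof.
rewrite dfallD; apply: eq_bigr => l _.
by rewrite -rmorph_dfall -mul_polyC polyCM polyC_natr.
Qed.

Lemma dstirling2_recurrence k m : (m <= k.+1)%N ->
  dstirling2 lam r k.+1 m%:Z =
    \sum_(l < k.+1)
      'C(k, l)%:R * dfall lam (1 - lam) (k - l) * dstirling2 lam r l (m%:Z - 1)
    + r%:R * \sum_(l < k.+1)
      'C(k, l)%:R * dfall lam (- lam) (k - l) * dstirling2 lam r l m%:Z.
Proof.
move: m; apply: dstirling2_unique.
rewrite dfallSl mulrDl.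
have -> : 'X + r%:R - lam%:P = (- lam)%:P + ('X + r%:R) :> {poly R}.
  by rewrite polyCN addrC.
(* Only the summand with factor [r] is expanded here; the other copy is regrouped first. *)
rewrite [in X in _ + X]dfallD_polyC.
have -> : (- lam)%:P + ('X + r%:R) = (1 - lam)%:P + ('X - 1 + r%:R) :> {poly R}.
  by rewrite polyCB polyCN polyC1; ring.
rewrite dfallD_polyC !mulr_sumr.
under eq_bigr => l _ do
  rewrite -scalerAr (mulX_dfall_shift _ _ (ltn_ord l)) scaler_sumr.
rewrite exchange_big /=.
(* The bound [k.+2] matches the range that the shift produced in the first summand. *)
under [X in _ + X]eq_bigr => l _ do
  rewrite (dstirling2_sum_widen _ _ (ltnW (ltn_ord l : l.+1 < k.+2)%N))
    scaler_sumr mulr_sumr.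
rewrite [X in _ + X]exchange_big /= -big_split; apply: eq_bigr => j _ /=.
rewrite scalerDl scaler_suml mulr_sumr scaler_suml; congr (_ + _).
  by apply: eq_bigr => l _; rewrite scalerA.
apply: eq_bigr => l _.
by rewrite -polyC_natr mul_polyC !scalerA.
Qed.

End DegenerateStirling.

Lemma big_ord_nat_start0 (V : nmodType) (F : nat -> V) m n :
    (forall l, (l < m)%N -> F l = 0) ->
  \sum_(l < n) F l = \sum_(m <= l < n) F l.
Proof.
move=> F0; rewrite big_geq_mkord [RHS]big_mkcond.
by apply: eq_bigr => l _ /=; case: leqP => // /F0.
Qed.

Theorem theorem7 (R : realType) (lam : R) (r m k : nat) (hmk : (m <= k)%N) :
  dstirling2 lam r k.+1 m%:Z =
    \sum_(m.-1 <= l < k.+1)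
      'C(k, l)%:R * dfall lam (1 - lam) (k - l) * dstirling2 lam r l (m%:Z - 1)
    + r%:R * \sum_(m <= l < k.+1)
      'C(k, l)%:R * dfall lam (- lam) (k - l) * dstirling2 lam r l m%:Z.
Proof.
rewrite dstirling2_recurrence ?(leqW hmk) //; congr (_ + _ * _).
  (* For [m = 0] the truncated start [m.-1] is 0, so no term is dropped. *)
  apply: big_ord_nat_start0 => l; case: m {hmk} => // m lt_lm.
  by rewrite dstirling2_out ?mulr0 // -predn_int // ltz_nat lt_lm orbT.
apply: big_ord_nat_start0 => l lt_lm.
by rewrite dstirling2_out ?mulr0 // ltz_nat lt_lm orbT.
Qed.
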